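(* Consider a matching market consisting of a finite simple bipartite graph $G=(V,E)$ with $V = D \sqcup H$ (doctors and hospitals), a matroid $\mathbf{M}_h=(E(h),\mathcal{I}_h)$ for each $h\in H$ in which every singleton $\{e\}$, $e\in E(h)$, is independent, preferences $\succsim_d$ for each $d\in D$, and responsive preferences $\succsim_h$ for each $h\in H$, all as specified in the context. Let $\mathcal{S}$ be the set of weakly stable matchings in $G$ (matchings $\mu$ such that no edge in $E\setminus\mu$ strongly blocks $\mu$), and let $\mathcal{C}$ be the weak core (the set of matchings $\mu$ in $G$ such that no non-empty subset of $V$ strongly blocks $\mu$). Then $\mathcal{S}\subseteq\mathcal{C}$.
   Context: Notation: for a set $X$ and an element $x$, $X+x := X\cup\{x\}$ and $X-x := X\setminus\{x\}$. Graph: $G=(V,E)$ is a finite simple undirected bipartite graph; $V$ is partitioned into $D$ (doctors) and $H$ (hospitals), and every edge joins a vertex of $D$ and a vertex of $H$. The edge joining $d\in D$ and $h\in H$, if it exists, is written $(d,h)$. For $F\subseteq E$ and $v\in V$, $F(v)$ is the set of edges of $F$ incident to $v$. Matroids: for each $h\in H$, $\mathbf{M}_h=(E(h),\mathcal{I}_h)$ is a matroid (with family of independent sets $\mathcal{I}_h$) such that $\{e\}\in\mathcal{I}_h$ for every $e\in E(h)$. If $I\in\mathcal{I}_h$, $e\in E(h)\setminus I$ and $I+e\notin\mathcal{I}_h$, then $\mathsf{C}_{\mathbf{M}_h}(e,I)$ denotes the fundamental circuit, i.e. the unique circuit of $\mathbf{M}_h$ contained in $I+e$ (it contains $e$), and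 $\mathsf{D}_{\mathbf{M}_h}(e,I):=\mathsf{C}_{\mathbf{M}_h}(e,I)-e$. Preferences: for each $d\in D$, $\succsim_d$ is a transitive and complete binary relation on $E(d)\cup\{\emptyset\}$ (complete: for all elements $e,f$, including $e=f$, at least one of $e\succsim_d f$, $f\succsim_d e$ holds) such that for every $e\in E(d)$, $e\succsim_d\emptyset$ and $\emptyset\not\succsim_d e$. For each $h\in H$, $\succsim_h$ is a transitive and complete binary relation on $\mathcal{I}_h$ such that for every non-empty $I\in\mathcal{I}_h$, $I\succsim_h\emptyset$ and $\emptyset\not\succsim_h I$. For $v\in V$, $a\succ_v b$ means $a\succsim_v b$ and $b\not\succsim_v a$; $a\sim_v b$ means $a\succsim_v b$ and $b\succsim_v a$. For $e,f\in E(h)$, write $e\succsim_h f$, $e\succ_h f$, $e\sim_h f$ for $\{e\}\succsim_h\{f\}$, $\{e\}\succ_h\{f\}$, $\{e\}\sim_h\{f\}$. Responsiveness: for every $h\in H$: (1) for every $I\in\mathcal{I}_h$ and $e\in I$, $I\succ_h I-e$; (2) for every $I\in\mathcal{I}_h$, $e\in E(h)\setminus I$ and $f\in I$ with $I+e-f\in\mathcal{I}_h$, we have $I+e-f\succsim_h I$ if and only if $e\succsim_h f$. Matchings: a matching in $G$ is a subset $\mu\subseteq E$ with $|\mu(d)|\le 1$ for every $d\in D$ and $\mu(h)\in\mathcal{I}_h$ for every $h\in H$. For a doctor $d$, $\mu(d)$ is identified with its unique element if non-empty (and is $\emptyset$ otherwise). Blocking edges: let $\mu$ be a matching and $e=(d,h)\in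 E\setminus\mu$. The edge $e$ strongly blocks $\mu$ on $d$ if $e\succ_d\mu(d)$. It strongly blocks $\mu$ on $h$ if either $\mu(h)+e\in\mathcal{I}_h$, or $\mu(h)+e\notin\mathcal{I}_h$ and there is $f\in\mathsf{D}_{\mathbf{M}_h}(e,\mu(h))$ with $e\succ_h f$. The edge $e$ strongly blocks $\mu$ if it strongly blocks $\mu$ on both $d$ and $h$. Blocking coalitions: for non-empty $C\subseteq V$, $E(C)$ is the set of edges $(d,h)\in E$ with $d,h\in C$, and $\mathcal{M}(C)$ is the set of matchings $\sigma$ in $G$ with $\sigma(v)\subseteq E(C)$ for every $v\in C$. A non-empty set $C\subseteq V$ strongly blocks a matching $\mu$ if there is $\sigma\in\mathcal{M}(C)$ with $\sigma(v)\succ_v\mu(v)$ for every $v\in C$. *)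

(* Defs.v *)
From mathcomp Require Import all_boot.

Set Implicit Arguments.
Unset Strict Implicit.
Unset Printing Implicit Defensive.

Section Matroids.

Variable T : finType.

Record matroid (S : {set T}) := Matroid {
  indep : {set {set T}};
  indep_ground : forall I : {set T}, I \in indep -> I \subset S;
  indep0 : set0 \in indep;
  indep_sub : forall I J : {set T}, J \in indep -> I \subset J -> I \in indep;
  indep_augment : forall I J : {set T}, I \in indep -> J \in indep -> #|I| < #|J| ->
    exists2 e, e \in J :\: I & e |: I \in indep
}.

Variables (S : {set T}) (M : matroid S).

Definition dependent (A : {set T}) : bool :=
  (A \subset S) && (A \notin indep M).

Definition circuit (C : {set T}) : bool := minset dependent C.

(* Only meaningful when [I] is independent, [e] lies in the ground set outside
   [I] and [e |: I] is not independent; by [fund_circuitP] below, the set picked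
   is then the unique circuit contained in [e |: I]. *)
Definition fund_circuit (e : T) (I : {set T}) : {set T} :=
  odflt set0 [pick C | circuit C && (C \subset e |: I)].

Definition fund_exchange (e : T) (I : {set T}) : {set T} :=
  fund_circuit e I :\ e.

Lemma circuit_dep C : circuit C -> dependent C.
Proof. by case/minsetP. Qed.

Lemma circuit_del (C : {set T}) f : circuit C -> f \in C -> C :\ f \in indep M.
Proof.
case/minsetP=> /andP[sCS _] minC fC; apply/negPn/negP=> nind.
have dep : dependent (C :\ f).
  by rewrite /dependent nind andbT (subset_trans (subD1set _ _) sCS).
have := minC _ dep (subD1set _ _).
by move/setP/(_ f); rewrite !inE eqxx fC.
Qed.

Lemma circuit_mem e (I C : {set T}) :
  I \in indep M -> circuit C -> C \subset e |: I -> e \in C.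
Proof.
move=> indI /circuit_dep/andP[_ depC] sC; apply/negPn/negP=> eC.
case/negP: depC; apply: (indep_sub indI).
apply/subsetP=> x xC; have := subsetP sC x xC.
rewrite !inE; case/orP=> // /eqP xe; by rewrite -xe xC in eC.
Qed.

Lemma indep_extend (A J K : {set T}) : J \in indep M -> K \in indep M ->
    J \subset A -> K \subset A ->
  exists L, [/\ L \in indep M, J \subset L, L \subset A & #|K| <= #|L|].
Proof.
move=> indJ indK sJA sKA.
have [n le_n] := ubnP (#|K| - #|J|).
elim: n => // n IHn in J indJ sJA le_n *.
have [leKJ|ltJK] := leqP #|K| #|J|; first by exists J; split.
have [x /setDP[xK xJ] indxJ] := indep_augment indJ indK ltJK.
have cxJ : #|x |: J| = #|J|.+1 by rewrite cardsU1 xJ.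
case: (IHn (x |: J) indxJ).
- by rewrite subUset sub1set sJA (subsetP sKA).
- by rewrite cxJ subnS -ltnS prednK ?subn_gt0.
move=> L [indL sL sLA leL]; exists L; split=> //.
by apply: subset_trans sL; apply: subsetUr.
Qed.

Lemma circuit_uniq e (I C1 C2 : {set T}) : I \in indep M -> e \notin I ->
    circuit C1 -> C1 \subset e |: I -> circuit C2 -> C2 \subset e |: I ->
  C1 = C2.
Proof.
move=> indI eI cC1 sC1 cC2 sC2.
have [sC12|] := boolP (C1 \subset C2).
  by case/minsetP: cC2 => _ /(_ C1 (circuit_dep cC1) sC12).
case/subsetPn=> f fC1 fC2.
have [L [indL sL sLA leL]] := indep_extend (circuit_del cC1 fC1) indI
  (subset_trans (subD1set _ _) sC1) (subsetUr _ _).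
have fL : f \notin L.
  apply/negP=> fL; case/andP: (circuit_dep cC1) => _ /negP; apply.
  apply: (indep_sub indL); by rewrite -(setD1K fC1) subUset sub1set fL.
have eqL : L = (e |: I) :\ f.
  apply/eqP; rewrite eqEcard; apply/andP; split.
    by rewrite subsetD1 sLA fL.
  have := cardsD1 f (e |: I); rewrite (subsetP sC1 _ fC1) cardsU1 eI.
  by move/addnI=> <-.
case/andP: (circuit_dep cC2) => _ /negP[]; apply: (indep_sub indL).
by rewrite eqL subsetD1 sC2 fC2.
Qed.

Lemma fund_circuitP e (I : {set T}) : I \in indep M -> e \in S :\: I ->
    e |: I \notin indep M ->
  forall C, (circuit C && (C \subset e |: I)) = (C == fund_circuit e I).
Proof.
move=> indI /setDP[eS eI] nind C; rewrite /fund_circuit.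
have dep : dependent (e |: I).
  by rewrite /dependent nind andbT subUset sub1set eS (indep_ground indI).
have [C0 cC0 sC0] := minset_exists dep.
case: pickP => [C1 /andP[cC1 sC1]|/(_ C0)]; last by rewrite /circuit cC0 sC0.
apply/andP/eqP=> [[cC sC]|->] //=; exact: (circuit_uniq indI eI).
Qed.

End Matroids.

Definition strict (A : Type) (r : rel A) : rel A :=
  fun a b => r a b && ~~ r b a.

(* A bipartite graph on [D] and [H] is given by its edge set [E : {set D * H}];
   its vertex type is [D + H]. *)
Section Market.

Variables D H : finType.

Definition star (F : {set D * H}) (v : D + H) : {set D * H} :=
  match v with
  | inl d => [set e in F | e.1 == d]
  | inr h => [set e in F | e.2 == h]
  end.

Variable E : {set D * H}.

(* E(d) together with the empty assignment, encoded as [None]; the relation of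
   a doctor is unconstrained, and never consulted, outside this set. *)
Definition doctor_options (d : D) : {pred option (D * H)} :=
  [pred o | if o is Some e then e \in star E (inl d) else true].

Record doctor_preference (d : D) (r : rel (option (D * H))) : Prop := {
  doctor_trans : {in doctor_options d & &, transitive r};
  doctor_complete : {in doctor_options d &, total r};
  doctor_acceptable : forall e, e \in star E (inl d) -> strict r (Some e) None
}.

Variable M : forall h : H, matroid (star E (inr h)).

Record hospital_preference (h : H) (r : rel {set D * H}) : Prop := {
  hospital_trans : {in indep (M h) & &, transitive r};
  hospital_complete : {in indep (M h) &, total r};
  hospital_acceptable : forall I : {set D * H}, I \in indep (M h) -> I != set0 ->
    strict r I set0
}.

Record responsive (h : H) (r : rel {set D * H}) : Prop := {
  responsive_mono : forall (I : {set D * H}) e, I \in indep (M h) -> e \in I ->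
    strict r I (I :\ e);
  responsive_exchange : forall (I : {set D * H}) e f, I \in indep (M h) ->
    e \in star E (inr h) :\: I -> f \in I -> (e |: I) :\ f \in indep (M h) ->
    r ((e |: I) :\ f) I <-> r [set e] [set f]
}.

Definition matching (mu : {set D * H}) : bool :=
  [&& mu \subset E,
      [forall d : D, #|star mu (inl d)| <= 1]
    & [forall h : H, star mu (inr h) \in indep (M h)]].

(* The identification of mu(d) with its unique element, if any. *)
Definition assignment (mu : {set D * H}) (d : D) : option (D * H) :=
  [pick e in star mu (inl d)].

Variables (prefD : D -> rel (option (D * H))) (prefH : H -> rel {set D * H}).

Definition strongly_blocks_doctor (mu : {set D * H}) (e : D * H) : bool :=
  strict (prefD e.1) (Some e) (assignment mu e.1).

Definition strongly_blocks_hospital (mu : {set D * H}) (e : D * H) : bool :=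
  let h := e.2 in
  let I := star mu (inr h) in
  (e |: I \in indep (M h)) ||
  ((e |: I \notin indep (M h)) &&
   [exists f in fund_exchange (M h) e I, strict (prefH h) [set e] [set f]]).

Definition edge_strongly_blocks (mu : {set D * H}) (e : D * H) : bool :=
  strongly_blocks_doctor mu e && strongly_blocks_hospital mu e.

Definition weakly_stable_matchings : {set {set D * H}} :=
  [set mu | matching mu &
     [forall e in E :\: mu, ~~ edge_strongly_blocks mu e]].

Definition induced_edges (C : {set D + H}) : {set D * H} :=
  [set e in E | (inl e.1 \in C) && (inr e.2 \in C)].

Definition coalition_matchings (C : {set D + H}) : {set {set D * H}} :=
  [set sigma | matching sigma &
     [forall v in C, star sigma v \subset induced_edges C]].

Definition strictly_prefers (v : D + H) (sigma mu : {set D * H}) : bool :=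
  match v with
  | inl d => strict (prefD d) (assignment sigma d) (assignment mu d)
  | inr h => strict (prefH h) (star sigma (inr h)) (star mu (inr h))
  end.

Definition coalition_strongly_blocks (C : {set D + H}) (mu : {set D * H}) :
    bool :=
  [exists sigma in coalition_matchings C,
     [forall v in C, strictly_prefers v sigma mu]].

Definition weak_core : {set {set D * H}} :=
  [set mu | matching mu &
     [forall C : {set D + H}, (C != set0) ==>
        ~~ coalition_strongly_blocks C mu]].

End Market.

(* Main.v *)
(** Suppose a coalition blocks a weakly stable matching [mu] through [sigma].
    It contains a hospital [h], and no edge of [J = sigma(h)] outside
    [I = mu(h)] strongly blocks [mu] on [h], since each strongly blocks [mu] on
    its doctor.  Hence every element [e] of [J \ I] closes a circuit with [I]
    whose other elements are all weakly better than [e].  Replacing the elements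
    of [J \ I] one by one by elements of these circuits yields an independent
    subset of [I] weakly better than [J], so [h] weakly prefers [I] to [J]. *)
Require Import Defs.
From mathcomp Require Import all_boot.

Set Implicit Arguments.
Unset Strict Implicit.
Unset Printing Implicit Defensive.

(** Grow the independent set [C :\ e] inside [J :|: C :\ e] to some [L] at least as large as [J]. As
    [L] cannot contain all of [C], it misses [e]. Being larger than [J :\ e], it can augment that
    set, and an element of [L] outside [J] can only come from [C :\ e]. *)
Lemma circuit_exchange (T : finType) (S : {set T}) (M : matroid S)
    (J C : {set T}) (e : T) :
  J \in indep M -> circuit M C -> e \in C -> e \in J ->
  exists f, [/\ f \in C :\ e, f \notin J & (f |: J) :\ e \in indep M].
Proof.
move=> indJ cC eC eJ.
have [L [indL sCL sLA leJL]] := indep_extend (circuit_del cC eC) indJ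
  (subsetUr J _) (subsetUl _ _).
have eL : e \notin L.
  apply/negP=> eL; case/andP: (circuit_dep cC) => _ /negP; apply.
  by apply: (indep_sub indL); rewrite -(setD1K eC) subUset sub1set eL.
have indJe : J :\ e \in indep M by apply: (indep_sub indJ); apply: subD1set.
have ltJL : #|J :\ e| < #|L|.
  by apply: leq_trans leJL; rewrite (cardsD1 e J) eJ.
have [f /setDP[fL fJe] indf] := indep_augment indJe indL ltJL.
have fe : f != e by apply: contraNneq eL => <-.
have fJ : f \notin J by move: fJe; rewrite !inE fe.
exists f; split=> //.
  by have := subsetP sLA f fL; rewrite in_setU (negPf fJ).
rewrite (_ : (f |: J) :\ e = f |: J :\ e) //.
by apply/setP=> x; rewrite !inE; case: (eqVneq x f) => [->|] //=; rewrite fe.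
Qed.

Section Hospital.

Variables (D H : finType) (E : {set D * H}).
Variable M : forall h : H, matroid (star E (inr h)).
Variables (h : H) (r : rel {set D * H}).
Hypothesis singleton_indep :
  forall e, e \in star E (inr h) -> [set e] \in indep (M h).
Hypothesis pref : hospital_preference M h r.
Hypothesis resp : responsive M h r.

(** Climb from [J] to [I] one element at a time, each addition being an improvement; completeness
    supplies reflexivity when [J] equals [I]. *)
Lemma responsive_subset (I J : {set D * H}) :
  I \in indep (M h) -> J \subset I -> r I J.
Proof.
move=> indI; have [n] := ubnP #|I :\: J|.
elim: n => // n IHn in J *; rewrite ltnS => le_n sJI.
have indJ := indep_sub indI sJI.
have [sIJ|/subsetPn[x xI xJ]] := boolP (I \subset J).
  have -> : I = J by apply/eqP; rewrite eqEsubset sIJ.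
  by case/orP: (hospital_complete pref indJ indJ).
have sxJI : x |: J \subset I by rewrite subUset sub1set xI.
have indxJ := indep_sub indI sxJI.
apply: (hospital_trans pref indxJ indI indJ).
  apply: IHn => //; apply: leq_trans le_n; apply: proper_card.
  apply/properP; split; first by apply: setDS; apply: subsetUr.
  by exists x; rewrite !inE ?eqxx // xJ.
by have /andP[] := responsive_mono resp indxJ (setU11 x J); rewrite setU1K.
Qed.

(** Induction on the size of [J :\: I]. A swap brings in an element of [I], so this difference only
    shrinks; both hypotheses survive because the circuits are always taken with respect to the fixed
    set [I]. *)
Lemma responsive_dominated (I J : {set D * H}) :
    I \in indep (M h) -> J \in indep (M h) ->
    (forall e, e \in J :\: I -> e |: I \notin indep (M h)) ->
    (forall e f, e \in J :\: I -> f \in fund_exchange (M h) e I ->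
       ~~ strict r [set e] [set f]) ->
  r I J.
Proof.
move=> indI; have [n] := ubnP #|J :\: I|.
elim: n => // n IHn in J *; rewrite ltnS => le_n indJ dep dom.
have [/(responsive_subset indI) //|/subsetPn[e eJ eI]] := boolP (J \subset I).
have eJI : e \in J :\: I by rewrite inE eI.
have eS := subsetP (indep_ground indJ) e eJ.
have eSI : e \in star E (inr h) :\: I by rewrite in_setD eI.
have /andP[cC sC] :
    circuit (M h) (fund_circuit (M h) e I) && (fund_circuit (M h) e I \subset e |: I).
  by rewrite (fund_circuitP indI eSI (dep e eJI)).
have [f [fC fJ indJ']] := circuit_exchange indJ cC
  (circuit_mem indI cC sC) eJ.
have /setD1P[fe fC'] := fC.
have fI : f \in I by have := subsetP sC f fC'; rewrite in_setU1 (negPf fe).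
have fS := subsetP (indep_ground indI) f fI.
have sJ'J : ((f |: J) :\ e) :\: I \subset (J :\: I) :\ e.
  apply/subsetP=> x; rewrite !inE => /and3P[xI -> /orP[/eqP xf|->]] /=.
    by rewrite xf fI in xI.
  by rewrite xI.
have sJ'J' := subset_trans sJ'J (subD1set _ _).
apply: (hospital_trans pref indJ' indI indJ).
  apply: IHn => //.
  - apply: leq_ltn_trans (subset_leq_card sJ'J) _.
    by apply: leq_trans le_n; rewrite (cardsD1 e (J :\: I)) eJI.
  - by move=> x /(subsetP sJ'J') /dep.
  - by move=> x y /(subsetP sJ'J') /dom; apply.
have fSJ : f \in star E (inr h) :\: J by rewrite in_setD fJ.
apply/(responsive_exchange resp indJ fSJ eJ indJ').
(* Passing from no strict preference to a weak one uses completeness, available because singletons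
   are independent. *)
have := dom e f eJI fC; rewrite /strict negb_and negbK => /orP[ner|//].
have := hospital_complete pref (singleton_indep eS) (singleton_indep fS).
by rewrite (negPf ner).
Qed.

End Hospital.

Lemma assignment_mem (D H : finType) (mu : {set D * H}) (d : D) (e : D * H) :
  assignment mu d = Some e -> e \in star mu (inl d).
Proof. by rewrite /assignment; case: pickP => // x xmu [<-]. Qed.

Lemma assignment_matching (D H : finType) (E : {set D * H})
    (M : forall h : H, matroid (star E (inr h))) (mu : {set D * H}) (e : D * H) :
  matching M mu -> e \in mu -> assignment mu e.1 = Some e.
Proof.
case/and3P=> _ /forallP/(_ e.1) /card_le1_eqP le1 _ emu.
have e_star : e \in star mu (inl e.1) by rewrite inE emu eqxx.
rewrite /assignment; case: pickP => [x x_star|/(_ e)]; last by rewrite e_star.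
by rewrite (le1 x e).
Qed.

Theorem theorem1 (D H : finType) (E : {set D * H})
    (M : forall h : H, matroid (star E (inr h)))
    (singleton_indep :
       forall (h : H) (e : D * H), e \in star E (inr h) -> [set e] \in indep (M h))
    (prefD : D -> rel (option (D * H)))
    (prefD_preference : forall d : D, doctor_preference E d (prefD d))
    (prefH : H -> rel {set D * H})
    (prefH_preference : forall h : H, hospital_preference M h (prefH h))
    (prefH_responsive : forall h : H, responsive M h (prefH h)) :
  weakly_stable_matchings M prefD prefH \subset weak_core M prefD prefH.
Proof.
apply/subsetP=> mu; rewrite !inE => /andP[mmu /forall_inP stable].
rewrite mmu; apply/forallP=> C; apply/implyP=> /set0Pn[v vC].
apply/negP=> /exists_inP[sigma]; rewrite inE => /andP[msigma /forall_inP sigmaC].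
move=> /forall_inP better.
have /and3P[sub_mu _ /forallP indmu] := mmu.
have /and3P[sub_sigma _ /forallP indsigma] := msigma.
(* A doctor of [C] is matched by [sigma], since being unmatched is never a strict improvement; the
   hospital of that edge is in [C]. *)
have [h hC] : exists h : H, inr h \in C.
  case: v vC => [d dC|h hC]; last by exists h.
  case sigma_d: (assignment sigma d) => [e|]; last first.
    have := better _ dC; rewrite /= sigma_d /strict.
    case mu_d: (assignment mu d) => [f|]; last by rewrite andbN.
    have := assignment_mem mu_d; rewrite inE => /andP[fmu fd].
    have fE : f \in star E (inl d) by rewrite inE (subsetP sub_mu) ?fmu.
    have /andP[_ /negPf nr] := doctor_acceptable (prefD_preference d) fE.
    by rewrite nr.
  have := subsetP (sigmaC _ dC) e (assignment_mem sigma_d).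
  by rewrite !inE => /and3P[_ _ eC]; exists e.2.
(* The doctor of [e] also belongs to [C] and receives [e] under [sigma], so [e] strongly blocks [mu]
   on that doctor; stability leaves only the hospital side to fail. *)
have unblocked e : e \in star sigma (inr h) :\: star mu (inr h) ->
    ~~ strongly_blocks_hospital M prefH mu e.
  case/setDP=> e_sigma; have := subsetP (sigmaC _ hC) e e_sigma.
  rewrite !inE => /and3P[eE dC _] ; move: e_sigma; rewrite inE => /andP[es ->].
  rewrite andbT => emu.
  have eEmu : e \in E :\: mu by rewrite in_setD emu.
  have := stable e eEmu; rewrite negb_and => /orP[|//].
  have := better _ dC; rewrite /= (assignment_matching msigma es).
  by rewrite /strongly_blocks_doctor => ->.
have := better _ hC => /andP[_ /negP]; apply.
apply: (responsive_dominated (@singleton_indep h)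
  (prefH_preference h) (prefH_responsive h) (indmu h) (indsigma h)).
- move=> e eJI; have := unblocked e eJI.
  (* Hospital blocking is phrased at [e.2], so [h] is replaced by it. *)
  have /eqP <- : e.2 == h by case/setDP: eJI; rewrite inE => /andP[].
  by rewrite negb_or => /andP[].
- move=> e f eJI; have := unblocked e eJI.
  have /eqP <- : e.2 == h by case/setDP: eJI; rewrite inE => /andP[].
  rewrite negb_or => /andP[-> /exists_inPn]; exact.
Qed.
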